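(* Let $\mathcal{H}=(C,F,D,G)$ be a hybrid system on $\mathbb{R}^n$. Let $K\subset\mathbb{R}^n$ be compact and suppose that $\mathcal{H}$ is nominally outer well-posed on $K$ and pre-forward complete from $K$. Let $\Omega\subset\mathbb{R}^n\times\mathbb{R}_{\geq 0}\times\mathbb{N}\times\mathbb{R}^n$ be a closed constraint set such that $\Omega\subset K\times\mathcal{T}\times X$ for some compact set $\mathcal{T}\subset\mathbb{R}_{\geq 0}\times\mathbb{N}$ and some $X\subset\mathbb{R}^n$, and let $\mathcal{J}$ be a cost function that is lower semicontinuous on $\Omega$. If the optimal control problem of minimizing $\mathcal{J}(x(0,0),(T,J),x(T,J))$ over all $x\in\widehat{\mathcal{S}}_{\mathcal{H}}$ subject to $(x(0,0),(T,J),x(T,J))\in\Omega$, where $(T,J)$ is the terminal hybrid time of $x$, is feasible, then it has an optimal solution.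
   Context: $\mathbb{N}=\{0,1,2,\dots\}$. A hybrid system $\mathcal{H}=(C,F,D,G)$ on $\mathbb{R}^n$ consists of sets $C,D\subset\mathbb{R}^n$ and set-valued maps $F,G:\mathbb{R}^n\rightrightarrows\mathbb{R}^n$ with $C\subset\mathrm{dom}\,F$, $D\subset\mathrm{dom}\,G$ (where $\mathrm{dom}$ of a set-valued map is the set where its values are nonempty), and represents $\dot x\in F(x)$ for $x\in C$, $x^+\in G(x)$ for $x\in D$. A set $E\subset\mathbb{R}_{\geq0}\times\mathbb{N}$ is a hybrid time domain if for every $(T,J)\in E$ there is a nondecreasing sequence $\{t_j\}_{j=0}^{J+1}$ with $t_0=0$ and $E\cap([0,T]\times\{0,\dots,J\})=\bigcup_{j=0}^{J}([t_j,t_{j+1}]\times\{j\})$. A hybrid arc is a function $x:\mathrm{dom}\,x\to\mathbb{R}^n$ such that $\mathrm{dom}\,x$ is a hybrid time domain and for each $j$, $t\mapsto x(t,j)$ is locally absolutely continuous on $I^j:=\{t:(t,j)\in\mathrm{dom}\,x\}$. It is a solution of $\mathcal{H}$ if $x(0,0)\in\mathrm{cl}(C)\cup D$; for each $j$, $x(t,j)\in C$ for all $t\in\mathrm{int}\,I^j$ and $\dot x(t,j)\in F(x(t,j))$ for almost all $t\in I^j$; and whenever $(t,j),(t,j+1)\in\mathrm{dom}\,x$, $x(t,j)\in D$ and $x(t,j+1)\in G(x(t,j))$. A solution originates from $x_0$ (from $S$) if $x(0,0)=x_0$ ($x(0,0)\in S$). It is maximal if it cannot be extended to another solution, complete if its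 domain is unbounded, bounded if its range is bounded. It escapes to infinity at hybrid time $(T,J)$ if $|x(t,J)|\to\infty$ as $t$ tends to $T$ from the left. $\mathcal{H}$ is pre-forward complete from $S$ if every maximal solution originating from $S$ is bounded or complete. If $\mathrm{dom}\,x$ is compact, its terminal hybrid time is the $(T,J)\in\mathrm{dom}\,x$ with $t\leq T$, $j\leq J$ for all $(t,j)\in\mathrm{dom}\,x$. $\widehat{\mathcal{S}}_{\mathcal{H}}$ is the set of all solutions of $\mathcal{H}$ (not necessarily maximal) with compact domain. A sequence $\{x_i\}$ of hybrid arcs is locally eventually bounded if for any $\tau\geq0$ there exist $i_0\geq 0$ and a compact set $K'$ such that $x_i(t,j)\in K'$ for all $i\geq i_0$ and $(t,j)\in\mathrm{dom}\,x_i$ with $t+j\leq\tau$. It converges graphically to a set-valued map $M:\mathbb{R}_{\geq0}\times\mathbb{N}\rightrightarrows\mathbb{R}^n$ (its graphical limit) if the graphs of $x_i$ converge to the graph of $M$ in the Painlevé–Kuratowski sense. $\mathcal{H}$ is nominally outer well-posed on $S\subset\mathbb{R}^n$ if for every graphically convergent sequence of solutions $\{x_i\}$ of $\mathcal{H}$ with $\lim_i x_i(0,0)=:x_0\in S$: (i) if $\{x_i\}$ is locally eventually bounded, the graphical limit is a solution of $\mathcal{H}$ originating from $x_0$; (ii) otherwise, there is $(T,J)\in\mathbb{R}_{\geq0}\times\mathbb{N}$ such that $x=M|_{\mathrm{dom}\,M\cap([0,T)\times\{0,\dots,J\})}$ is a solution of $\mathcal{H}$ originating from $x_0$ that escapes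 to infinity at hybrid time $(T,J)$, where $M$ is the graphical limit. A cost function is a function $\mathcal{J}:\mathbb{R}^n\times\mathbb{R}_{\geq0}\times\mathbb{N}\times\mathbb{R}^n\to\mathbb{R}_{\geq0}$. A feasible solution is an $x\in\widehat{\mathcal{S}}_{\mathcal{H}}$ satisfying the constraint; the problem is feasible if one exists. An optimal solution is a feasible solution attaining the infimum of the cost over all feasible solutions.
   Formalization: Hybrid time domains are additionally required to have any two points comparable (t≤t' and j≤j', or the reverse); the stated definition also admits branching domains, under which blow-up solutions are never maximal and the claim fails. *)

(* Defs.v *)
From HB Require Import structures.
From mathcomp Require Import all_boot all_order all_algebra.
From mathcomp Require Import all_classical all_reals all_analysis.
Set Implicit Arguments.
Unset Strict Implicit.
Unset Printing Implicit Defensive.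
Import Order.TTheory GRing.Theory Num.Theory.
Import numFieldNormedType.Exports.
Local Open Scope classical_set_scope.
Local Open Scope ring_scope.

(* Points of R^n are row vectors 'rV[R]_n, with the library's sup norm.       *)
(* A set-valued map from S to T is a function S -> set T.  Points of          *)
(* R_{>=0} x N are pairs in R * nat with nonnegative first component.         *)

Section SetValuedMaps.
Context {S T : Type}.

Definition sv_dom (M : S -> set T) : set S := [set s | M s !=set0].

Definition sv_graph (M : S -> set T) : set (S * T) := [set p | M p.1 p.2].

Definition sv_restrict (M : S -> set T) (A : set S) : S -> set T :=
  fun s => [set v | A s /\ M s v].

End SetValuedMaps.

Section SetConvergence.
Context {T : topologicalType}.

Definition inner_limit (A : nat -> set T) : set T :=
  [set p | forall U, nbhs p U -> \forall i \near \oo, A i `&` U !=set0].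

Definition outer_limit (A : nat -> set T) : set T :=
  [set p | forall U, nbhs p U ->
    forall N : nat, exists2 i, (N <= i)%N & A i `&` U !=set0].

Definition painleve_kuratowski (A : nat -> set T) (L : set T) : Prop :=
  inner_limit A = L /\ outer_limit A = L.

End SetConvergence.

Section AbsoluteContinuity.
Context {R : realType} {V : normedModType R}.

Definition abs_continuous (a b : R) (f : R -> V) : Prop :=
  forall eps : R, 0 < eps -> exists2 delta : R, 0 < delta &
    forall (m : nat) (u v : 'I_m -> R),
      (forall i, a <= u i /\ u i <= v i /\ v i <= b) ->
      trivIset [set: 'I_m] (fun i => `]u i, v i[%classic) ->
      \sum_(i < m) (v i - u i) < delta ->
      \sum_(i < m) `|f (v i) - f (u i)| < eps.

Definition locally_abs_continuous (I : set R) (f : R -> V) : Prop :=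
  forall a b : R, a <= b -> `[a, b] `<=` I -> abs_continuous a b f.

End AbsoluteContinuity.

Section HybridSystems.
Context {R : realType}.

(* The second condition alone would also admit branching sets such as         *)
(* [0, 2] x {0} U {(1, 1)}; these have no terminal time and are not what is   *)
(* meant by a hybrid time domain, i.e. a finite or infinite union of          *)
(* consecutive intervals [t_j, t_{j+1}] x {j} (the last one possibly          *)
(* half-open).  The third condition, that any two points are comparable,      *)
(* excludes exactly these.                                                    *)
Definition hybrid_time_domain (E : set (R * nat)) : Prop :=
  [/\ E `<=` [set p | 0 <= p.1],
      forall T J, E (T, J) -> exists t : nat -> R,
        [/\ t 0%N = 0,
            forall j, (j <= J)%N -> t j <= t j.+1 &
            E `&` [set p | 0 <= p.1 <= T /\ (p.2 <= J)%N] =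
            \bigcup_(j in [set j | (j <= J)%N])
              (`[t j, t j.+1] `*` [set j])] &
      forall p q, E p -> E q ->
        (p.1 <= q.1 /\ (p.2 <= q.2)%N) \/ (q.1 <= p.1 /\ (q.2 <= p.2)%N)].

Definition time_slice (E : set (R * nat)) (j : nat) : set R :=
  [set t | E (t, j)].

Definition terminal_time (E : set (R * nat)) (p : R * nat) : Prop :=
  E p /\ forall q, E q -> q.1 <= p.1 /\ (q.2 <= p.2)%N.

Lemma terminal_time_unique (E : set (R * nat)) p q :
  terminal_time E p -> terminal_time E q -> p = q.
Proof.
case: p q => [s i] [t j] [Ep Mp] [Eq Mq].
have [/= ts ji] := Mp _ Eq; have [/= st ij] := Mq _ Ep.
by congr pair; apply/eqP; [rewrite eq_le ts st | rewrite eqn_leq ij ji].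
Qed.

Lemma terminal_time_exists (E : set (R * nat)) :
  hybrid_time_domain E -> E !=set0 -> compact E -> exists p, terminal_time E p.
Proof.
move=> [_ _ cmp] E0 cE.
have cf : continuous (fun p : R * nat => p.1 + p.2%:R : R).
  move=> p; apply: cvgD; first exact: cvg_fst.
  apply: (@cvg_comp _ _ _ snd (fun k : nat => k%:R : R) _ (nbhs p.2)).
    exact: cvg_snd.
  move=> B /nbhs_singleton Bp.
  suff: nbhs p.2 ((fun k : nat => k%:R : R) @^-1` B) by [].
  by apply: (filterS _ (discrete_set1 p.2)) => _ ->.
have [p /set_mem Ep Mp] :=
  compact_EVT_max E0 cE (continuous_subspaceT cf).
exists p; split=> // q Eq.
have [//|[pq1 pq2]] := cmp _ _ Eq Ep.
have /= := Mp _ (mem_set Eq); rewrite -lerBrDr -addrA => le1.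
have le2 : (p.2%:R : R) <= q.2%:R by rewrite ler_nat.
split; first by rewrite (le_trans le1)// gerDl subr_le0.
rewrite -(ler_nat R) -(lerD2l p.1) (le_trans _ (Mp _ (mem_set Eq)))//.
by rewrite lerD2r.
Qed.

Context {n : nat}.

(* The values of [arc_fun] outside [arc_dom] are irrelevant: all notions      *)
(* below depend on an arc only through its set-valued map [arc_map].          *)
Record hybrid_arc := HybridArc {
  arc_dom : set (R * nat);
  arc_fun :> R * nat -> 'rV[R]_n;
  arc_htd : hybrid_time_domain arc_dom;
  arc_lac : forall j,
    locally_abs_continuous (time_slice arc_dom j) (fun t => arc_fun (t, j))
}.

Definition arc_map (x : hybrid_arc) : R * nat -> set 'rV[R]_n :=
  fun p => [set v | arc_dom x p /\ v = x p].

Record hybrid_system := HybridSystem {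
  flow_set : set 'rV[R]_n;
  flow_map : 'rV[R]_n -> set 'rV[R]_n;
  jump_set : set 'rV[R]_n;
  jump_map : 'rV[R]_n -> set 'rV[R]_n;
  flow_set_dom : flow_set `<=` sv_dom flow_map;
  jump_set_dom : jump_set `<=` sv_dom jump_map
}.

Definition solution (H : hybrid_system) (x : hybrid_arc) : Prop :=
  [/\ arc_dom x (0, 0%N),
      (closure (flow_set H) `|` jump_set H) (x (0, 0%N)),
      forall j,
        (forall t, (time_slice (arc_dom x) j)° t -> flow_set H (x (t, j))) /\
        {ae lebesgue_measure, forall t : R, time_slice (arc_dom x) j t ->
           derivable (fun s : R => x (s, j)) t 1 /\
           flow_map H (x (t, j)) (derive1 (fun s : R => x (s, j)) t)} &
      forall t j, arc_dom x (t, j) -> arc_dom x (t, j.+1) ->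
        jump_set H (x (t, j)) /\ jump_map H (x (t, j)) (x (t, j.+1))].

Definition extends (x y : hybrid_arc) : Prop :=
  sv_graph (arc_map x) `<=` sv_graph (arc_map y).

Definition maximal_solution (H : hybrid_system) (x : hybrid_arc) : Prop :=
  solution H x /\
  forall y, solution H y -> extends x y -> arc_map y = arc_map x.

Definition complete_arc (x : hybrid_arc) : Prop :=
  ~ exists B : R, forall p, arc_dom x p -> p.1 + p.2%:R <= B.

Definition bounded_arc (x : hybrid_arc) : Prop :=
  bounded_set [set x p | p in arc_dom x].

Definition escapes_to_infinity (x : hybrid_arc) (T : R) (J : nat) : Prop :=
  (\forall t \near T^'-, arc_dom x (t, J)) /\
  (`|x (t, J)| @[t --> T^'-] --> +oo).

Definition pre_forward_complete (H : hybrid_system) (S : set 'rV[R]_n) : Prop :=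
  forall x, maximal_solution H x -> S (x (0, 0%N)) ->
    bounded_arc x \/ complete_arc x.

Definition locally_eventually_bounded (x : nat -> hybrid_arc) : Prop :=
  forall tau : R, 0 <= tau -> exists (i0 : nat) (K' : set 'rV[R]_n),
    compact K' /\
    forall i p, (i0 <= i)%N -> arc_dom (x i) p -> p.1 + p.2%:R <= tau ->
      K' (x i p).

Definition graphically_converges
    (x : nat -> hybrid_arc) (M : R * nat -> set 'rV[R]_n) : Prop :=
  painleve_kuratowski (fun i => sv_graph (arc_map (x i))) (sv_graph M).

Definition nominally_outer_well_posed
    (H : hybrid_system) (S : set 'rV[R]_n) : Prop :=
  forall (x : nat -> hybrid_arc) (M : R * nat -> set 'rV[R]_n) (x0 : 'rV[R]_n),
    (forall i, solution H (x i)) ->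
    graphically_converges x M ->
    x i (0, 0%N) @[i --> \oo] --> x0 ->
    S x0 ->
    (locally_eventually_bounded x ->
       exists y : hybrid_arc,
         [/\ arc_map y = M, solution H y & y (0, 0%N) = x0]) /\
    (~ locally_eventually_bounded x ->
       exists (T : R) (J : nat) (y : hybrid_arc), 0 <= T /\
         [/\ arc_map y =
               sv_restrict M [set p | 0 <= p.1 < T /\ (p.2 <= J)%N],
             solution H y, y (0, 0%N) = x0 & escapes_to_infinity y T J]).

Definition compact_solution (H : hybrid_system) (x : hybrid_arc) : Prop :=
  solution H x /\ compact (arc_dom x).

Definition terminal (x : hybrid_arc) : R * nat :=
  get (terminal_time (arc_dom x)).

Definition endpoints (x : hybrid_arc) : 'rV[R]_n * (R * nat) * 'rV[R]_n :=
  (x (0, 0%N), terminal x, x (terminal x)).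

Definition feasible (H : hybrid_system)
    (Omega : set ('rV[R]_n * (R * nat) * 'rV[R]_n)) (x : hybrid_arc) : Prop :=
  compact_solution H x /\ Omega (endpoints x).

Definition optimal (H : hybrid_system)
    (Omega : set ('rV[R]_n * (R * nat) * 'rV[R]_n))
    (cost : 'rV[R]_n * (R * nat) * 'rV[R]_n -> R) (x : hybrid_arc) : Prop :=
  feasible H Omega x /\
  cost (endpoints x) = inf [set cost (endpoints y) | y in feasible H Omega].

End HybridSystems.

Arguments hybrid_arc : clear implicits.
Arguments hybrid_system : clear implicits.

(* Main.v *)
Require Import Defs.
From mathcomp Require Import all_boot all_order all_algebra.
From mathcomp Require Import all_classical all_reals all_analysis.
Import Order.TTheory GRing.Theory Num.Theory.
Import numFieldNormedType.Exports.
Local Open Scope classical_set_scope.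
Local Open Scope ring_scope.

(** The minimum is attained because the endpoint data of feasible solutions
    form a compact set, on which the lower semicontinuous cost attains its
    infimum.  Let [x i] be feasible.  The graphs of the [x i] are subsets of a
    second countable space, where every sequence of sets has a convergent
    subsequence ([painleve_kuratowski_compactness]); since [K] is compact the
    initial points may be assumed to converge in [K] as well.

    Outer well-posedness now leaves two cases.  If the subsequence were not
    locally eventually bounded, a truncation of its graphical limit would be a
    solution [y] from [K] that escapes to infinity at some time [(T, J)].  Such
    a [y] is maximal ([escaping_solution_maximal]): a proper extension would be
    defined at [(T, J)], hence absolutely continuous, hence bounded, on a
    segment of the [J]-th slice ending at [T].  But [y] is neither bounded nor
    complete, contrary to pre-forward completeness ([no_escape]).

    So the subsequence is locally eventually bounded and its graphical limit
    is a solution [y].  As the terminal times stay in a compact set, the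
    endpoint triples stay in a compact set too and have a cluster point
    [(a, p, xi)].  It lies in the closed set [Omega], and it is the endpoint
    triple of [y]: graphical convergence puts [xi] on the graph of [y] at [p],
    and keeps the domain of [y] before [p] ([cluster_terminal]).  Hence [y] is
    feasible ([feasible_endpoints_cluster]); for a minimizing sequence, lower
    semicontinuity makes [y] optimal. *)

Set Implicit Arguments.
Unset Strict Implicit.

(** * Compactness of set convergence *)

(** A diagonal extraction without recursion: any finitely many of the [P k]
    that belong to the ultrafilter have common elements beyond any rank, so
    [phi N] can be chosen in those of code less than [N]. *)
Lemma ultrafilter_subsequence (F : set_system nat) (I : countType)
    (P : I -> set nat) : UltraFilter F -> \oo `<=` F ->
  exists phi : nat -> nat, (forall i, (i <= phi i)%N) /\
    forall k, F (P k) -> \forall i \near \oo, P k (phi i).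
Proof.
move=> UF ooF.
have FQ N : F [set i | forall k, (pickle k < N)%N -> F (P k) -> P k i].
  elim: N => [|N IH].
    by apply: filterS (@filterT _ F _) => i _ k.
  have [[k [kN FPk]]|noN] := pselect (exists k, pickle k = N /\ F (P k)).
    apply: filterS (filterI IH FPk) => i [Qi Pki] k' + FPk'.
    rewrite ltnS leq_eqVlt => /orP[/eqP k'N|/Qi/(_ FPk')//].
    by rewrite (pcan_inj pickleK (etrans k'N (esym kN))).
  apply: filterS IH => i Qi k + FPk.
  rewrite ltnS leq_eqVlt => /orP[/eqP kN|/Qi/(_ FPk)//].
  by case: noN; exists k.
have /choice[phi phiP] (N : nat) : exists i, (N <= i)%N /\
    forall k, (pickle k < N)%N -> F (P k) -> P k i.
  apply: (@filter_ex _ F); apply: filterI (FQ N).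
  by apply: ooF; exact: nbhs_infty_ge.
exists phi; split=> [i|k FPk]; first by case: (phiP i).
near=> i; have [_] := phiP i; apply=> //.
near: i; exact: nbhs_infty_gt.
Unshelve. all: by end_near. Qed.

(** An ultrafilter decides, for each basic open set [W], whether almost all of
    the sets meet [W] or almost all avoid it.  Along a subsequence realizing
    these countably many decisions, a point all of whose neighborhoods are met
    infinitely often has all of them met eventually, so the inner and outer
    limits agree.  The convergence of [u] is extracted at the same time, as
    countably many further conditions. *)
Lemma painleve_kuratowski_compactness (R : realType) (T : topologicalType)
    (V : pseudoMetricType R) (A : nat -> set T) (u : nat -> V) (K : set V) :
  @second_countable T -> compact K -> (forall i, K (u i)) ->
  exists (phi : nat -> nat) (a : V), [/\ forall i, (i <= phi i)%N,
    painleve_kuratowski (A \o phi) (inner_limit (A \o phi)), K a &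
    (u \o phi) i @[i --> \oo] --> a].
Proof.
move=> [B cB [oB Bcvg]] cK Ku.
(* [e] lists the basis; it takes the harmless value [set0] off the codes. *)
have [f finj] := elimT (countable_injP _) cB.
pose e k : set T := xget set0 [set U | B U /\ f U = k].
have eB U : B U -> e (f U) = U.
  move=> BU; rewrite /e; case: xgetP => [U' _ [BU' fU']|/(_ U) []//].
  by apply: finj => //; exact: mem_set.
have [F [UF ooF]] := @ultraFilterLemma nat \oo _.
have [a [Ka ua]] : K `&` [set a | u i @[i --> F] --> a] !=set0.
  have [a [Ka cla]] := cK (u @ F) _ (filterS (fun i _ => Ku i) filterT).
  exists a; split=> //= W aW.
  have [//|FW] := in_ultra_setVsetC (u @^-1` W) UF.
  by have [v []] := cla (~` W) W FW aW.
(* The summands ask in turn that the sets meet basic open sets, that they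
   avoid them, and that [u] is close to [a]. *)
pose P (k : nat + nat + nat) : set nat := match k with
  | inl (inl k) => [set i | A i `&` e k !=set0]
  | inl (inr k) => ~` [set i | A i `&` e k !=set0]
  | inr k => [set i | ball a k.+1%:R^-1 (u i)] end.
have [phi [phi_ge phiP]] := ultrafilter_subsequence P UF ooF.
exists phi, a; split=> //.
- split=> //; apply/seteqP; split=> p; last first.
    move=> ip U pU N; have [M _ MP] := ip U pU.
    by exists (maxn N M); [exact: leq_maxl | apply: MP; exact: leq_maxr].
  move=> op U pU; have [W [BW Wp] WU] := Bcvg p _ pU.
  have pW : nbhs p W by apply: open_nbhs_nbhs; split=> //; exact: oB.
  have [/(phiP (inl (inl (f W))))|/(phiP (inl (inr (f W))))] :=
    in_ultra_setVsetC (P (inl (inl (f W)))) UF.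
    apply: filterS => i /=; rewrite eB// => -[q [Aq Wq]].
    by exists q; split=> //; exact: WU.
  move=> [N _ NP]; have [i Ni Ai] := op W pW N.
  by have := NP i Ni; rewrite /= eB// => /(_ Ai).
- apply/cvg_ballP => eps eps0.
  have [N] := ltr_add_invr eps0; rewrite add0r => Neps.
  apply: filterS (phiP (inr N) _) => [i /=|]; first exact/le_ball/ltW.
  by apply: ua; apply: nbhsx_ballx.
Qed.

Lemma dense_second_countable (R : realType) (T : pseudoMetricType R)
    (D : set T) : countable D -> dense D -> @second_countable T.
Proof.
move=> cD dD; pose f k (z : T) : set T := (ball z k.+1%:R^-1)°.
exists (\bigcup_k f k @` D); [|split].
- by apply: bigcup_countable => // k _; exact: sub_countable (card_image_le _ _) cD.
- by move=> _ [k _ [z _ <-]]; exact: open_interior.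
move=> x V /nbhs_ballP[eps eps0 xV].
have [N] := ltr_add_invr (divr_gt0 eps0 (ltr0Sn _ 1)); rewrite add0r => Neps.
pose g : R := N.+1%:R^-1; have g0 : 0 < g by rewrite invr_gt0.
have g20 : 0 < g / 2 by exact: divr_gt0.
have [z [xz Dz]] : (ball x (g / 2))° `&` D !=set0.
  by apply: dD; [exists x; exact: nbhsx_ballx | exact: open_interior].
(* Radius [g / 2] around [x], not [g], so that [x] is interior to [ball z g]. *)
have {}xz : ball x (g / 2) z by exact: interior_subset.
exists (f N z); first split; first by exists N => //; exists z.
  apply: (@filterS _ (nbhs x) _ (ball x (g / 2))) (nbhsx_ballx x _ g20) => w xw.
  by rewrite -/g (splitr g); apply: ball_triangle xw; exact: ball_sym.
move=> w /interior_subset zw; apply: xV.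
rewrite (splitr eps); apply: ball_triangle (le_ball (ltW Neps) zw).
apply: le_ball xz; rewrite (le_trans _ (ltW Neps))// -/g ler_pdivrMr//.
by rewrite ler_peMr ?ler1n// ltW.
Qed.

Lemma second_countable_hybrid_graph_space (R : realType) (n : nat) :
  @second_countable ((R * nat) * 'rV[R]_n)%type.
Proof.
pose q (c : (rat * nat) * 'rV[rat]_n) : (R * nat) * 'rV[R]_n :=
  ((ratr c.1.1, c.1.2), map_mx ratr c.2).
apply: (@dense_second_countable R _ (range q)).
  exact: sub_countable (card_image_le _ _) (countableP _).
move=> O [[[t j] v] Op]; rewrite openE => /(_ _ Op)/nbhs_ballP[eps /= eps0 OB].
have approx (r : R) : exists c : rat, ball r eps (ratr c).
  have [w [/interior_subset rw [c _ cw]]] : (ball r eps)° `&` range ratr !=set0.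
    by apply: dense_rat; [exists r; exact: nbhsx_ballx | exact: open_interior].
  by exists c; rewrite cw.
have [t' tt'] := approx t.
have [v' vv'] := choice (fun k => approx (v ord0 k)).
exists (q ((t', j), \row_k v' k)); split; last by eexists.
apply: OB; split; first by split => //=; exact: ballxx.
by split=> // i k; rewrite !mxE ord1; exact: vv'.
Qed.

(** * Hybrid time domains *)

Lemma continuous_total_time (R : realType) :
  continuous (fun p : R * nat => p.1 + p.2%:R : R).
Proof.
move=> p; apply: cvgD; first exact: cvg_fst.
apply: (@cvg_comp _ _ _ snd (fun k : nat => k%:R : R) _ (nbhs p.2)).
  exact: cvg_snd.
move=> W /nbhs_singleton Wp.
by apply: (filterS _ (discrete_set1 p.2)) => _ ->.
Qed.

Lemma at_left_ex2 (R : realType) (T : R) (P Q : set R) :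
  (\forall t \near T^'-, P t) -> (\forall t \near T^'-, Q t) ->
  exists t, P t /\ Q t.
Proof. by move=> TP TQ; apply: (@filter_ex _ T^'-); exact: filterI. Qed.

Section HybridTimeDomains.
Context {R : realType}.
Implicit Types E : set (R * nat).

(** Up to its terminal time, a hybrid time domain is a finite union of compact
    segments. *)
Lemma compact_hybrid_time_domain E p :
  hybrid_time_domain E -> terminal_time E p -> compact E.
Proof.
case: p => T J [E0 htd _] [ETJ maxTJ].
have [t [_ _ Et]] := htd T J ETJ.
have <- : E `&` [set p | 0 <= p.1 <= T /\ (p.2 <= J)%N] = E.
  apply: setIidl => p Ep; have [pT pJ] := maxTJ p Ep.
  by split=> //; rewrite pT andbT; exact: E0.
rewrite Et -[[set j | _]]/(`I_J.+1) bigcup_mkord.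
apply: bigsetU_compact => j _.
by apply: compact_setX; [exact: segment_compact | exact: compact_set1].
Qed.

(** Extending a hybrid time domain does not add points to its past.  If the
    jumps of [E] up to [p] are at the times [t j], then [E'] contains both
    [(t j, j - 1)] and [(t j.+1, j.+1)]; a point [(s, j)] of [E'] is comparable
    with them only if [t j <= s <= t j.+1], and then it is in [E].  For the first
    and the last [j] the bounds [0 <= s] and [s <= p.1] replace these points. *)
Lemma hybrid_time_domain_past E E' p q :
    hybrid_time_domain E -> hybrid_time_domain E' -> E `<=` E' ->
  E p -> E' q -> q.1 <= p.1 -> (q.2 <= p.2)%N -> E q.
Proof.
case: p q => [T J] [s j] [E0 htd _] [E'0 _ cmp] EE' Ep E'q /= sT jJ.
have [t [t0 tle Et]] := htd T J Ep.
have Etj k r : (k <= J)%N -> t k <= r <= t k.+1 ->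
    E (r, k) /\ 0 <= r <= T.
  move=> kJ tr; have : (\bigcup_(j in [set j | (j <= J)%N])
      (`[t j, t j.+1] `*` [set j])) (r, k).
    by exists k => //; split=> //=; rewrite in_itv.
  by rewrite -Et => -[? [? _]].
have tJ : T <= t J.+1.
  have : (E `&` [set p | 0 <= p.1 <= T /\ (p.2 <= J)%N]) (T, J).
    by split=> //; split=> //=; rewrite lexx andbT; exact: (E0 _ Ep).
  by rewrite Et => -[k _ [/= /[swap] <-]]; rewrite in_itv => /andP[].
suff /(Etj _ _ jJ)[] : t j <= s <= t j.+1 by [].
apply/andP; split.
  case: j E'q jJ => [|j] E'q jJ; first by rewrite t0; exact: (E'0 _ E'q).
  have [Etj1 _] : E (t j.+1, j) /\ 0 <= t j.+1 <= T.
    by apply: Etj; rewrite ?lexx ?andbT ?tle// ltnW.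
  by have [[/= _]|[]//] := cmp _ _ E'q (EE' _ Etj1); rewrite ltnn.
move: jJ; rewrite leq_eqVlt => /orP[/eqP->|jJ]; first exact: le_trans tJ.
have [Etj1 _] : E (t j.+1, j.+1) /\ 0 <= t j.+1 <= T.
  by apply: Etj; rewrite ?lexx ?tle.
by have [[]//|[/= _]] := cmp _ _ E'q (EE' _ Etj1); rewrite ltnn.
Qed.

Lemma time_slice_segment E p j : hybrid_time_domain E -> E p -> (j <= p.2)%N ->
  exists a b : R, forall s, s <= p.1 -> E (s, j) <-> 0 <= s /\ a <= s <= b.
Proof.
case: p => [T J] [E0 htd _] Ep /= jJ; have [t [_ _ Et]] := htd T J Ep.
exists (t j), (t j.+1) => s sT; split=> [Es|[s0 ts]].
  have : (E `&` [set p | 0 <= p.1 <= T /\ (p.2 <= J)%N]) (s, j).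
    by split=> //; split=> //=; rewrite sT andbT; exact: (E0 _ Es).
  rewrite Et => -[k _ [/= /[swap] <-]]; rewrite in_itv; split=> //.
  exact: (E0 _ Es).
have : (\bigcup_(j in [set j | (j <= J)%N])
    (`[t j, t j.+1] `*` [set j])) (s, j).
  by exists j => //; split=> //=; rewrite in_itv.
by rewrite -Et => -[].
Qed.

(** Only the last slice of a hybrid time domain can be open on the right, and
    the existence of [q] says that the [J]-th one goes on to [T] or is followed
    by a jump: up to the time of [q] it is a closed segment. *)
Lemma hybrid_time_domain_endpoint E (T : R) (J : nat) q :
    hybrid_time_domain E -> (\forall t \near T^'-, E (t, J)) ->
  E q -> T <= q.1 -> (J <= q.2)%N -> E (T, J).
Proof.
move=> htdE ET Eq Tq Jq; have [a [b Eab]] := time_slice_segment htdE Eq Jq.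
have ab : \forall s \near T^'-, [/\ s < T, 0 <= s & a <= s <= b].
  near=> s.
  have sT : s < T by near: s; exact: nbhs_left_lt.
  have Es : E (s, J) by near: s.
  by have [s0 asb] := iffLR (Eab s (le_trans (ltW sT) Tq)) Es; split.
apply/(Eab T Tq).
have /filter_ex[s [sT s0 /andP[as_ _]]] := ab.
split; first exact: le_trans s0 (ltW sT).
rewrite (le_trans as_ (ltW sT)) /= leNgt; apply/negP => /nbhs_left_gt bT.
have [r [[_ _ /andP[_ rb]] br]] := at_left_ex2 ab bT.
by move: br; rewrite ltNge rb.
Unshelve. all: by end_near. Qed.

End HybridTimeDomains.

(** * Escape to infinity *)

Section HybridSystems.
Context {R : realType} {n : nat}.
Implicit Types (x y z : hybrid_arc R n) (H : hybrid_system R n).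

(** An absolutely continuous function on [[s, T]] is bounded near [T]. *)
Lemma escaping_arc_no_endpoint y z (T : R) (J : nat) :
  escapes_to_infinity y T J -> extends y z -> ~ arc_dom z (T, J).
Proof.
move=> [yT /cvgryPgt yoo] yz zT.
have yzE t : arc_dom y (t, J) -> arc_dom z (t, J) /\ y (t, J) = z (t, J).
  move=> yt; have : sv_graph (arc_map z) ((t, J), y (t, J)) by exact: yz.
  by case.
have [s [ys sT]] := at_left_ex2 yT (nbhs_left_lt T).
have sTz : `[s, T] `<=` time_slice (arc_dom z) J.
  move=> r /=; rewrite in_itv /= => /andP[sr rT].
  have [a [b zab]] := time_slice_segment (arc_htd z) zT (leqnn J).
  have [_ /andP[as_ _]] := iffLR (zab s (ltW sT)) (proj1 (yzE _ ys)).
  have [_ /andP[_ Tb]] := iffLR (zab T (lexx _)) zT.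
  apply/(zab r rT); rewrite (le_trans as_ sr) (le_trans rT Tb); split=> //.
  by apply: le_trans sr; case: (arc_htd y) => /(_ _ ys).
have [d d0 zd] := arc_lac (ltW sT) sTz ltr01.
have bounded : \forall t \near T^'-, `|y (t, J)| <= `|z (T, J)| + 1.
  near=> t.
  have tT : t < T by near: t; exact: nbhs_left_lt.
  have st : s < t by near: t; exact: nbhs_left_gt.
  have dt : T - t < d by near: t; exact: nbhs_left_ltBl.
  have yt : arc_dom y (t, J) by near: t.
  have [_ ->] := yzE t yt.
  have zlt : `|z (T, J) - z (t, J)| < 1.
    (* Absolute continuity with a single interval is continuity at [T]. *)
    have := zd 1%N (fun=> t) (fun=> T); rewrite !big_ord1; apply=> //.
      by move=> _; split; [exact: ltW | split; [exact: ltW|]].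
    by apply/trivIsetP => i j; rewrite !ord1 eqxx.
  rewrite -[in leLHS](subKr (z (T, J)) (z (t, J))).
  by rewrite (le_trans (ler_normB _ _))// lerD2l ltW.
have [t [/= tle tgt]] := at_left_ex2 bounded (yoo (`|z (T, J)| + 1)).
by move: tgt; rewrite ltNge tle.
Unshelve. all: by end_near. Qed.

(** A point added by an extension cannot lie in the past of the points
    [(t, J)] with [t] close to [T], by [hybrid_time_domain_past], so it comes after all
    of them; then [(T, J)] is in the extended domain as well. *)
Lemma escaping_solution_maximal H y (T : R) (J : nat) :
    solution H y -> escapes_to_infinity y T J ->
  maximal_solution H y.
Proof.
move=> Hy yesc; split=> // z Hz yz.
have [yT _] := yesc.
have yzE p : arc_dom y p -> arc_dom z p /\ y p = z p.
  by move=> yp; have : sv_graph (arc_map z) (p, y p) by exact: yz.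
have zy q : arc_dom z q -> arc_dom y q.
  move=> zq.
  have zT : ~ (T <= q.1 /\ (J <= q.2)%N).
    move=> [Tq Jq]; apply: (escaping_arc_no_endpoint yesc yz).
    apply: hybrid_time_domain_endpoint (arc_htd z) _ zq Tq Jq.
    by apply: filterS yT => t /yzE[].
  have past s : arc_dom y (s, J) -> q.1 <= s -> (q.2 <= J)%N -> arc_dom y q.
    move=> ys; apply: hybrid_time_domain_past (arc_htd y) (arc_htd z) _ ys zq.
    by move=> p /yzE[].
  have [_ _ cmp] := arc_htd z.
  have [Tq|qT] := leP T q.1.
    have [s [ys sT]] := at_left_ex2 yT (nbhs_left_lt T).
    have [[/= qs _]|[/= _ Jq]] := cmp _ _ zq (proj1 (yzE _ ys)).
      by move: sT; rewrite ltNge (le_trans Tq qs).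
    by case: zT.
  have [s [ys qs]] := at_left_ex2 yT (nbhs_left_gt qT).
  have [[]|[/= sq _]] := cmp _ _ zq (proj1 (yzE _ ys)); first exact: past.
  by move: qs; rewrite ltNge sq.
apply/funext => p; apply/seteqP; split=> v [domv ->].
  by split; [exact: zy | have [] := yzE _ (zy _ domv)].
by have [zp ->] := yzE _ domv.
Qed.

Lemma terminalP H x :
  compact_solution H x -> terminal_time (arc_dom x) (terminal x).
Proof.
move=> [[x0 _ _ _] cx]; apply: getPex.
by apply: terminal_time_exists cx; [exact: arc_htd | exists (0, 0%N)].
Qed.

(** Otherwise well-posedness provides an escaping solution from [K]; being
    maximal it has to be bounded, which escape forbids, or complete, although
    its hybrid times are bounded by [T + J]. *)
Lemma no_escape H (K : set 'rV[R]_n) (x : nat -> hybrid_arc R n)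
    (M : R * nat -> set 'rV[R]_n) (x0 : 'rV[R]_n) :
    nominally_outer_well_posed H K -> pre_forward_complete H K ->
    (forall i, solution H (x i)) -> graphically_converges x M ->
    x i (0, 0%N) @[i --> \oo] --> x0 -> K x0 ->
  locally_eventually_bounded x.
Proof.
move=> wpH pfcH Hx xM xx0 Kx0; apply: contrapT => unb.
have [_ /(_ unb)[T [J [y [T0 [yM Hy y0 yesc]]]]]] := wpH x M x0 Hx xM xx0 Kx0.
have Ky0 : K (y (0, 0%N)) by rewrite y0.
have [yb|] := pfcH _ (escaping_solution_maximal Hy yesc) Ky0; last first.
  apply; exists (T + J%:R) => p yp.
  have : arc_map y p (y p) by [].
  by rewrite yM => -[[/andP[_ pT] pJ] _]; rewrite lerD ?ler_nat// ltW.
have [N [_ Nb]] := yb; have [yT /cvgryPgt yoo] := yesc.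
have [t [yt]] := at_left_ex2 yT (yoo (N + 1)).
rewrite ltNge => /negP; apply; apply: (Nb (N + 1)); first by rewrite ltrDl.
by exists (t, J).
Qed.

(** * Limits of feasible solutions *)

(** The points [(terminal (x i), x i (terminal (x i)))] are on the graphs, so
    their cluster point [(p, xi)] is in the outer limit, the graph of [y].
    Conversely a point [q] of [arc_dom y] is, by inner convergence, close to
    points of [arc_dom (x i)] for almost all [i], among them indices where
    [terminal (x i)] is close to [p]; so [q] cannot be beyond [p]. *)
Lemma cluster_terminal H (x : nat -> hybrid_arc R n) y
    (a xi : 'rV[R]_n) (p : R * nat) :
    (forall i, compact_solution H (x i)) ->
    graphically_converges x (arc_map y) ->
    cluster (endpoints (x i) @[i --> \oo]) (a, p, xi) ->
  terminal_time (arc_dom y) p /\ y p = xi.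
Proof.
move=> Hx [xin xout] cl.
have [/= yp ->] : arc_map y p xi.
  suff : sv_graph (arc_map y) (p, xi) by [].
  rewrite -xout => U pU N.
  have V : nbhs (a, p, xi) [set e | U (e.1.2, e.2)].
    have [[A B] /= [pA xiB] ABU] := pU.
    exists ([set e | A e.2], B); last by move=> e [Ae Be]; exact: ABU.
    by split=> //=; exact: cvg_snd pA.
  have FN : (endpoints (x i) @[i --> \oo])
      [set endpoints (x i) | i in [set i | (N <= i)%N]].
    by exists N => // i Ni; exists i.
  have [e [[i Ni <-] Ui]] := cl _ _ FN V.
  exists i => //; exists (terminal (x i), x i (terminal (x i))); split=> //.
  by have [] := terminalP (Hx i).
split=> //; split=> // q yq.
have : sv_graph (arc_map y) (q, y q) by [].
rewrite -xin => qin.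
have near_p eps : 0 < eps -> q.1 - eps < p.1 + eps /\ (q.2 <= p.2)%N.
  move=> eps0.
  have Fq := qin _ (nbhsx_ballx (q, y q) _ eps0).
  have pU := nbhsx_ballx (a, p, xi) _ eps0.
  have [e [[i [w [[xw _] [[wt wj] _]]] <-] [[_ [pt pj]] _]]] := cl
    [set endpoints (x i) | i in [set i |
      sv_graph (arc_map (x i)) `&` ball (q, y q) eps !=set0]] _
    (filterS (fun i Ai => ex_intro2 _ _ i Ai erefl) Fq) pU.
  have [_ /(_ _ xw)[tle jle]] := terminalP (Hx i).
  split; last by rewrite wj pj.
  move: wt pt; rewrite /ball /= !ltr_distlC => /andP[qt _] /andP[_ tp].
  exact: lt_trans (lt_le_trans qt tle) tp.
have [_ qp2] := near_p 1 ltr01; split=> //.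
rewrite leNgt; apply/negP => pq.
have := near_p ((q.1 - p.1) / 2) _; rewrite divr_gt0 ?subr_gt0// => /(_ isT)[].
by rewrite ltrBlDr -addrA -splitr addrC subrK ltxx.
Qed.

(** This is compactness of the set of endpoint triples of feasible solutions,
    in the sequential form that a minimization needs: the cluster point is
    realized by a feasible solution. *)
Lemma feasible_endpoints_cluster H (K : set 'rV[R]_n)
    (Omega : set ('rV[R]_n * (R * nat) * 'rV[R]_n)) (TT : set (R * nat))
    (X : set 'rV[R]_n) (x : nat -> hybrid_arc R n) :
    compact K -> nominally_outer_well_posed H K -> pre_forward_complete H K ->
    closed Omega -> compact TT -> Omega `<=` K `*` TT `*` X ->
    (forall i, feasible H Omega (x i)) ->
  exists y, feasible H Omega y /\
    cluster (endpoints (x i) @[i --> \oo]) (endpoints y).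
Proof.
move=> compactK wpH pfcH closedO compactTT OmegaS Fx.
have [phi [x0 [phi_ge conv Kx0 xx0]]] := painleve_kuratowski_compactness
  (fun i => sv_graph (arc_map (x i))) (second_countable_hybrid_graph_space R n)
  compactK (fun i => (OmegaS _ (Fx i).2).1.1).
pose M p := [set v | inner_limit
  (fun i => sv_graph (arc_map (x (phi i)))) (p, v)].
have xM : graphically_converges (x \o phi) M.
  have gM : sv_graph M = inner_limit (fun i => sv_graph (arc_map (x (phi i)))).
    by apply/seteqP; split=> -[].
  by rewrite /graphically_converges gM.
have Hx i : solution H ((x \o phi) i) := (Fx (phi i)).1.1.
have bnd := no_escape wpH pfcH Hx xM xx0 Kx0.
have [/(_ bnd)[y [yM Hy y0]] _] := wpH _ _ _ Hx xM xx0 Kx0.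
have [N [_ TTN]] := compact_bounded (continuous_compact
  (continuous_subspaceT (@continuous_total_time R)) compactTT).
(* The total terminal times are at most [N + 1]; the maximum makes this horizon
   nonnegative whatever [N] is. *)
have tau_ge0 : 0 <= Num.max 0 (N + 1) by rewrite le_max lexx.
have [i0 [K' [cK' xK']]] := bnd _ tau_ge0.
have in_compact : (endpoints (x (phi i)) @[i --> \oo]) (K `*` TT `*` K').
  exists i0 => // i /= i0i; have [Kx Tx] := (OmegaS _ (Fx (phi i)).2).1.
  split=> //; apply: xK' => //.
    by have [] := terminalP (Fx (phi i)).1.
  rewrite le_max; apply/orP; right.
  apply: le_trans (ler_norm _) _; apply: (TTN (N + 1)); first by rewrite ltrDl.
  by exists (terminal (x (phi i))).
have [[[a p] xi] [_ cl]] :=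
  compact_setX (compact_setX compactK compactTT) cK' _ in_compact.
have [yp yxi] : terminal_time (arc_dom y) p /\ y p = xi.
  apply: cluster_terminal (fun i => (Fx (phi i)).1) _ cl.
  by rewrite yM.
have ax0 : a = x0.
  apply: norm_hausdorff => A B aA x0B.
  have FB : (endpoints (x (phi i)) @[i --> \oo]) [set e | B e.1.1].
    exact: xx0.
  have pA : nbhs (a, p, xi) [set e | A e.1.1].
    exists ([set e | A e.1], setT) => [|e []//].
    by split=> /=; [exact: cvg_fst aA | exact: filterT].
  by have [e [Be Ae]] := cl _ _ FB pA; exists e.1.1.
have endy : endpoints y = (a, p, xi).
  rewrite /endpoints /terminal.
  rewrite (terminal_time_unique (getPex (ex_intro _ p yp)) yp).
  by rewrite y0 yxi ax0.
have Oy : Omega (endpoints y).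
  rewrite endy; apply: closedO => W pW; apply: cl pW.
  by exists 0%N => // i _; exact: (Fx _).2.
exists y; split.
  split=> //; split=> //.
  exact: compact_hybrid_time_domain (arc_htd y) yp.
rewrite endy => A W [N0 _ A0] pW; apply: cl pW.
by exists N0 => // i /= N0i; apply: A0; exact: leq_trans (phi_ge i).
Qed.

End HybridSystems.

Unset Implicit Arguments.
Set Strict Implicit.

Theorem theorem8 (R : realType) (n : nat) (H : hybrid_system R n)
  (K : set 'rV[R]_n) (compactK : compact K)
  (wpH : nominally_outer_well_posed H K)
  (pfcH : pre_forward_complete H K)
  (Omega : set ('rV[R]_n * (R * nat) * 'rV[R]_n)) (closedO : closed Omega)
  (TT : set (R * nat)) (TT_ge0 : TT `<=` [set p | 0 <= p.1])
  (compactTT : compact TT) (X : set 'rV[R]_n)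
  (OmegaS : Omega `<=` K `*` TT `*` X)
  (cost : 'rV[R]_n * (R * nat) * 'rV[R]_n -> R)
  (cost_ge0 : forall p, 0 <= p.1.2.1 -> 0 <= cost p)
  (lsc_cost : @lower_semicontinuous (subspace Omega) R (EFin \o cost)) :
  (exists x : hybrid_arc R n, feasible H Omega x) ->
  exists x : hybrid_arc R n, optimal H Omega cost x.
Proof.
move=> [z feasz].
pose costs := [set cost (endpoints y) | y in feasible H Omega].
have lb_costs : lbound costs 0.
  move=> _ [y [_ /OmegaS[[_ Ty] _]] <-]; apply: cost_ge0; exact: TT_ge0 Ty.
have costs_inf : has_inf costs.
  by split; [exists (cost (endpoints z)), z | exists 0].
have /choice[x xP] (i : nat) : exists y, feasible H Omega y /\
    cost (endpoints y) < inf costs + i.+1%:R^-1.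
  have [|_ [y feasy <-] ylt] := inf_adherent (eps := i.+1%:R^-1) _ costs_inf.
    by rewrite invr_gt0.
  by exists y.
have [y [feasy cl]] := feasible_endpoints_cluster compactK wpH pfcH closedO
  compactTT OmegaS (fun i => (xP i).1).
have Oy := feasy.2.
exists y; split=> //; apply/eqP; rewrite eq_le; apply/andP; split; last first.
  by apply: ge_inf; [case: costs_inf | exists y].
rewrite leNgt; apply/negP => /midf_lt[]; set c := (_ / 2) => infc cy.
have [V yV Vc] := lsc_cost (endpoints y) c cy.
have {}yV : within Omega (nbhs (endpoints y)) V by rewrite nbhs_subspace_in.
have Fc : (endpoints (x i) @[i --> \oo]) [set e | Omega e /\ cost e < c].
  have [k] := ltr_add_invr infc => kc.
  exists k => // i /= ki; split; first exact: (xP _).1.2.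
  apply: lt_trans (xP _).2 _; apply: le_lt_trans kc; rewrite lerD2l.
  by rewrite lef_pV2 ?posrE// ler_nat ltnS.
have [e [[Oe ec] /(_ Oe)/Vc]] := cl _ _ Fc yV.
by rewrite lte_fin ltNge ltW.
Qed.
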